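(* Let $\mathbf P=(P,\leq,{}',0,1)$ be an orthogonal poset. Then $\mathbf P$ is orthomodular if and only if for all $x,y\in P$, $x\leq y$ implies $y\mathrel\Delta x$.
   Context: An orthoposet is a tuple $(P,\leq,{}',0,1)$ where $(P,\leq,0,1)$ is a bounded poset and ${}'$ is a unary operation on $P$ such that $x\leq y$ implies $y'\leq x'$, $x''=x$, and for every $x$ the supremum $x\vee x'$ exists and equals $1$ and the infimum $x\wedge x'$ exists and equals $0$. Elements $x,y$ are orthogonal, $x\perp y$, if $x\leq y'$. An orthogonal poset is an orthoposet in which the supremum $x\vee y$ exists whenever $x\perp y$. An orthogonal poset is orthomodular if $x\leq y$ implies $x\vee(x\vee y')'=y$. For $A\subseteq P$ let $L(A)$ and $U(A)$ be the sets of all lower bounds and of all upper bounds of $A$ in $P$; several arguments (elements or subsets) denote the bounds of the union, e.g. $L(a,b)=L(\{a,b\})$, $U(A,B)=U(A\cup B)$. For $a,b\in P$, $a\mathrel\Delta b$ means $U(a)=U(L(a,b),L(a,b'))$. *)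

(* Defs.v *)
From mathcomp Require Import all_boot all_order.
From mathcomp Require Import boolp classical_sets.

Set Implicit Arguments.
Unset Strict Implicit.
Unset Printing Implicit Defensive.

Import Order.TTheory.
Local Open Scope order_scope.
Local Open Scope classical_set_scope.

(* Joins and meets are partial operations in a poset, so they are relations:
   [is_join x y s] says that the supremum of x and y exists and equals s. *)
Definition is_join (disp : Order.disp_t) (P : porderType disp) (x y s : P) :
  Prop := supremums [set x; y] s.

Definition is_meet (disp : Order.disp_t) (P : porderType disp) (x y m : P) :
  Prop := infimums [set x; y] m.

Record is_orthoposet (disp : Order.disp_t) (P : tbPOrderType disp)
    (compl : P -> P) : Prop := IsOrthoposet {
  compl_anti : forall x y : P, x <= y -> compl y <= compl x;
  compl_involutive : forall x : P, compl (compl x) = x;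
  compl_join : forall x : P, is_join x (compl x) \top;
  compl_meet : forall x : P, is_meet x (compl x) \bot
}.

Definition orthogonal (disp : Order.disp_t) (P : porderType disp)
  (compl : P -> P) (x y : P) : Prop := x <= compl y.

Record is_orthogonal_poset (disp : Order.disp_t) (P : tbPOrderType disp)
    (compl : P -> P) : Prop := IsOrthogonalPoset {
  orthogonal_poset_orthoposet : is_orthoposet compl;
  orthogonal_join : forall x y : P,
    orthogonal compl x y -> exists s : P, is_join x y s
}.

(* x \/ (x \/ y')' = y, where s is the inner join x \/ y'. Both joins exist
   in an orthogonal poset when x <= y. *)
Definition is_orthomodular (disp : Order.disp_t) (P : tbPOrderType disp)
  (compl : P -> P) : Prop :=
  forall x y : P, x <= y ->
    exists2 s : P, is_join x (compl y) s & is_join x (compl s) y.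

Definition Delta (disp : Order.disp_t) (P : porderType disp)
  (compl : P -> P) (a b : P) : Prop :=
  ubound [set a] = ubound (lbound [set a; b] `|` lbound [set a; compl b]).

(* Main.v *)
Require Import Defs.
From mathcomp Require Import all_boot all_order.
From mathcomp Require Import boolp classical_sets.

(** For x <= y the elements x and y' are orthogonal, so s = x \/ y' exists and,
    by De Morgan, s' = y /\ x'. Hence L(y,x) = L(x) and L(y,x') = L(s'), so that
    y Delta x says U(y) = U(x,s'), i.e. y = x \/ s' = x \/ (x \/ y')'. *)

Import Order.TTheory.
Local Open Scope order_scope.
Local Open Scope classical_set_scope.

Lemma ubound_set1P (disp : Order.disp_t) (P : porderType disp) (a u : P) :
  ubound [set a] u <-> a <= u.
Proof. by split=> [|au _ ->//]; apply. Qed.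

Lemma ubound_set2P (disp : Order.disp_t) (P : porderType disp) (a b u : P) :
  ubound [set a; b] u <-> a <= u /\ b <= u.
Proof.
split=> [ub|[au bu] _ [->|->]//].
by split; apply: ub; [left|right].
Qed.

Lemma lbound_set2P (disp : Order.disp_t) (P : porderType disp) (a b l : P) :
  lbound [set a; b] l <-> l <= a /\ l <= b.
Proof.
split=> [lb|[la lb] _ [->|->]//].
by split; apply: lb; [left|right].
Qed.

(** Puts a join into the form of [Delta], an equality of sets of upper bounds: the cone above [s] is
    the set of common upper bounds exactly when [s] is the least of them. *)
Lemma is_joinP (disp : Order.disp_t) (P : porderType disp) (a b s : P) :
  is_join a b s <-> ubound [set s] = ubound [set a; b].
Proof.
split=> [[/ubound_set2P[as_ bs] least]|E].
  apply/seteqP; split=> u.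
    move=> /ubound_set1P su; apply/ubound_set2P.
    by split; [exact: le_trans su|exact: le_trans su].
  by move=> /least su; apply/ubound_set1P.
split; first by rewrite -E; apply/ubound_set1P.
by move=> u; rewrite -E => /ubound_set1P.
Qed.

(** De Morgan: an antitone involution turns the upper bounds of x and y' into the lower bounds of x'
    and y. *)
Lemma lbound_compl_join (disp : Order.disp_t) (P : tbPOrderType disp)
    (compl : P -> P) (hP : is_orthoposet compl) (x y s : P) :
  is_join x (compl y) s ->
  lbound [set y; compl x] = lbound [set compl s].
Proof.
have anti := compl_anti hP.
have complK := compl_involutive hP.
move=> [/ubound_set2P[xs ys] least]; apply/seteqP; split=> l.
  move=> /lbound_set2P[ly lx] _ ->.
  (* Writing l as l'' reduces the goal to s <= l', which holds once l' is above x and y'. *)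
  rewrite -(complK l); apply: (anti); apply: least; apply/ubound_set2P.
  by split; [rewrite -(complK x)|]; apply: anti.
move=> /(_ _ erefl) ls; apply/lbound_set2P; split; apply: le_trans ls _.
  by rewrite -(complK y); apply: anti.
exact: anti.
Qed.

(** Each principal down-set L(a) has greatest element a, so bounding it from above amounts to
    bounding a. *)
Lemma ubound_lbounds (disp : Order.disp_t) (P : porderType disp) (a b : P) :
  ubound (lbound [set a] `|` lbound [set b]) = ubound [set a; b].
Proof.
apply/seteqP; split=> u.
  by move=> ub; apply/ubound_set2P; split; apply: ub;
    [left => _ ->|right => _ ->].
move=> /ubound_set2P[au bu] l.
by case=> /(_ _ erefl) le_l; exact: le_trans le_l _.
Qed.

(** The join [s] is taken as given, so that the equivalence serves both directions of the theorem:
    orthomodularity supplies [s] in one, orthogonality in the other. *)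
Lemma Delta_is_join (disp : Order.disp_t) (P : tbPOrderType disp)
    (compl : P -> P) (hP : is_orthoposet compl) (x y s : P) :
  x <= y -> is_join x (compl y) s ->
  Delta compl y x <-> is_join x (compl s) y.
Proof.
move=> xy joins; rewrite /Delta (lbound_compl_join _ _ _ hP _ _ _ joins).
have -> : lbound [set y; x] = lbound [set x].
  apply/seteqP; split=> l; first by move=> /lbound_set2P[_ lx] _ ->.
  by move=> /(_ _ erefl) lx; apply/lbound_set2P; split=> //; exact: le_trans xy.
by rewrite ubound_lbounds is_joinP.
Qed.

Local Close Scope classical_set_scope.

Theorem proposition3p4 (disp : Order.disp_t) (P : tbPOrderType disp)
    (compl : P -> P) (hP : is_orthogonal_poset compl) :
  is_orthomodular compl <->
  (forall x y : P, x <= y -> Delta compl y x).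
Proof.
have hO := orthogonal_poset_orthoposet hP.
split=> [om x y xy|hD x y xy].
  by have [s js jy] := om x y xy; apply/(Delta_is_join _ _ _ hO _ _ _ xy js).
have [s js] : exists s, is_join x (compl y) s.
  (* Since y'' = y, the hypothesis x <= y says that x is orthogonal to y'. *)
  by apply: (orthogonal_join hP); rewrite /orthogonal (compl_involutive hO).
by exists s => //; apply/(Delta_is_join _ _ _ hO _ _ _ xy js); exact: hD.
Qed.
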